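(* Suppose that $\mathcal{Y}=\{\mathbf{y}\in\{0,1\}^n\mid(\mathbf{g}^1)^\top\mathbf{y}\ge h_1,\ldots,(\mathbf{g}^J)^\top\mathbf{y}\ge h_J\}$, and let $\mathcal{J}=\{1,\ldots,J\}$ denote the set of constraint indices. Suppose we are given collections of subsets of indices $\mathcal{J}_1^1,\ldots,\mathcal{J}_k^1$ and $\mathcal{J}_1^2,\ldots,\mathcal{J}_q^2$ with $\bigcup_{i=1}^k\mathcal{J}_i^1\subseteq\mathcal{J}$ and $\bigcup_{i=1}^q\mathcal{J}_i^2\subseteq\mathcal{J}$. For an arbitrary set $\mathcal{J}_i\subseteq\mathcal{J}$, let $\mathcal{D}^{\mathcal{J}_i}$ and $\mathcal{D}_{\mathtt{outer}}^{\mathcal{J}_i}$ denote an exact and a relaxed decision diagram, respectively, for the feasible set described by the constraints with indices in $\mathcal{J}_i$, i.e. for $\{\mathbf{y}\in\{0,1\}^n\mid(\mathbf{g}^j)^\top\mathbf{y}\ge h_j\ \forall j\in\mathcal{J}_i\}$. Then the model $$\begin{aligned}\min_{\mathbf{x},\mathbf{y},\boldsymbol{\lambda}}\quad&\mathbf{c}^\top\mathbf{x}+\mathbf{d}^\top\boldsymbol{\lambda}\\ \text{s.t.}\quad&\mathbf{T}^\top\boldsymbol{\lambda}=\mathbf{y},\\ &\mathbf{y}\in\operatorname{proj}_{\mathbf{y}}(\mathrm{NF}(\mathcal{D}^{\mathcal{J}_i}))\quad\forall\mathcal{J}_i\in\{\mathcal{J}_1^1,\ldots,\mathcal{J}_k^1\},\\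 &\mathbf{y}\in\operatorname{proj}_{\mathbf{y}}(\mathrm{NF}(\mathcal{D}_{\mathtt{outer}}^{\mathcal{J}_i}))\quad\forall\mathcal{J}_i\in\{\mathcal{J}_1^2,\ldots,\mathcal{J}_q^2\},\\ &\mathbf{y}\in\operatorname{rel}(\mathcal{Y}),\\ &\mathbf{y}\in\mathcal{S}(\mathbf{x}),\\ &\mathbf{x}\in\mathcal{X},\ \boldsymbol{\lambda}\ge\mathbf{0}\end{aligned}$$ generates a feasible solution $\mathbf{x}\in\mathcal{X}$ (the $\mathbf{x}$-component of any optimal solution), and its optimal value is a lower bound on the optimal objective value of $$\min_{\mathbf{x}\in\mathcal{X}}\ \max_{\boldsymbol{\xi}\in\Xi}\ \min_{\mathbf{y}\in\mathcal{Y}\cap\mathcal{S}(\mathbf{x})}\ \mathbf{c}^\top\mathbf{x}+\boldsymbol{\xi}^\top\mathbf{y}.$$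
   Context: Problem data: $m,n$ are positive integers, $\mathbf{c}\in\mathbb{R}^m$, $\mathcal{X}\subseteq\{0,1\}^m$, $\mathbf{g}^1,\ldots,\mathbf{g}^J\in\mathbb{R}^n$, $h_1,\ldots,h_J\in\mathbb{R}$, $\operatorname{rel}(\mathcal{Y})=\{\mathbf{y}\in[0,1]^n\mid(\mathbf{g}^j)^\top\mathbf{y}\ge h_j,\ j=1,\ldots,J\}$ is the continuous relaxation of $\mathcal{Y}$, and $\Xi=\{\boldsymbol{\xi}\in\mathbb{R}^n\mid\mathbf{T}\boldsymbol{\xi}\le\mathbf{d}\}$ is a nonempty bounded polyhedron. The problem has selective adaptability: for pairwise disjoint $\mathcal{U}_1,\mathcal{U}_2,\mathcal{U}_3\subseteq\{1,\ldots,n\}\times\{1,\ldots,m\}$, $$\mathcal{S}(\mathbf{x})=\{\mathbf{y}\in\mathbb{R}^n\mid y_i\le x_j\ \forall(i,j)\in\mathcal{U}_1,\ y_i=x_j\ \forall(i,j)\in\mathcal{U}_2,\ y_i\ge x_j\ \forall(i,j)\in\mathcal{U}_3\}.$$ The minimum over an empty (infeasible) set is $+\infty$. Decision diagram: a directed acyclic (multi)graph $\mathcal{D}=(\mathcal{V},\mathcal{A})$ whose nodes are partitioned into $n+1$ nonempty layers $\mathcal{V}_1,\ldots,\mathcal{V}_{n+1}$ with $\mathcal{V}_1=\{\mathtt{r}\}$ and $\mathcal{V}_{n+1}=\{\mathtt{t}\}$; each arc goes from a node of $\mathcal{V}_i$ to a node of $\mathcal{V}_{i+1}$ for some $i\in\{1,\ldots,n\}$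 and carries a label 0 or 1. $\mathcal{A}_i^1$ is the set of arcs with label 1 leaving nodes of $\mathcal{V}_i$. A path from $\mathtt{r}$ to $\mathtt{t}$ maps to the vector $\mathbf{y}\in\{0,1\}^n$ with $y_i$ equal to the label of its arc leaving layer $i$. For a set $\mathcal{B}\subseteq\{0,1\}^n$, an exact decision diagram of $\mathcal{B}$ is one whose $\mathtt{r}$–$\mathtt{t}$ paths map to exactly the set $\mathcal{B}$; a relaxed decision diagram of $\mathcal{B}$ is one whose $\mathtt{r}$–$\mathtt{t}$ paths map to a superset of $\mathcal{B}$. Network flow polyhedron: $$\mathrm{NF}(\mathcal{D})=\Big\{(\mathbf{y},\mathbf{z})\in\mathbb{R}^n\times\mathbb{R}_+^{|\mathcal{A}|}\ \Big|\ \mathbf{A}\mathbf{z}=\mathbf{b},\ y_i=\sum_{j\in\mathcal{A}_i^1}z_j\ \forall i\in\{1,\ldots,n\}\Big\},$$ where $\mathbf{A}\in\{-1,0,1\}^{|\mathcal{V}|\times|\mathcal{A}|}$ is the node-arc incidence matrix (entry $-1$ at the tail and $+1$ at the head of each arc), and $\mathbf{b}$ is zero except for $-1$ at $\mathtt{r}$ and $1$ at $\mathtt{t}$. $\operatorname{proj}_{\mathbf{y}}$ denotes projection onto the $\mathbf{y}$ coordinates. *)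

(* Defs.v *)
From HB Require Import structures.
From mathcomp Require Import all_boot all_order all_algebra.
From mathcomp Require Import all_classical all_reals all_analysis.

Set Implicit Arguments.
Unset Strict Implicit.
Unset Printing Implicit Defensive.

Import Order.TTheory GRing.Theory Num.Theory.
Import numFieldNormedType.Exports.

Local Open Scope classical_set_scope.
Local Open Scope ring_scope.

Definition dot {R : realType} {n : nat} (u v : 'cV[R]_n) : R :=
  (u^T *m v) 0 0.

Definition binary {R : realType} {n : nat} (y : 'cV[R]_n) : Prop :=
  forall i, y i 0 = 0 \/ y i 0 = 1.

Definition constraint_set {R : realType} {n J : nat}
    (g : 'I_J -> 'cV[R]_n) (h : 'I_J -> R) (S : {set 'I_J}) : set 'cV[R]_n :=
  [set y : 'cV[R]_n | binary y /\ forall j, j \in S -> h j <= dot (g j) y].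

Definition recourse_set {R : realType} {n J : nat}
    (g : 'I_J -> 'cV[R]_n) (h : 'I_J -> R) : set 'cV[R]_n :=
  [set y : 'cV[R]_n | binary y /\ forall j, h j <= dot (g j) y].

Definition recourse_relaxation {R : realType} {n J : nat}
    (g : 'I_J -> 'cV[R]_n) (h : 'I_J -> R) : set 'cV[R]_n :=
  [set y : 'cV[R]_n | (forall i, 0 <= y i 0 <= 1) /\ forall j, h j <= dot (g j) y].

Definition polyhedron {R : realType} {p n : nat}
    (T : 'M[R]_(p, n)) (d : 'cV[R]_p) : set 'cV[R]_n :=
  [set xi : 'cV[R]_n | forall i, (T *m xi) i 0 <= d i 0].

Definition selective {R : realType} {m n : nat}
    (U1 U2 U3 : {set 'I_n * 'I_m}) (x : 'cV[R]_m) : set 'cV[R]_n :=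
  [set y : 'cV[R]_n | [/\ forall i j, (i, j) \in U1 -> y i 0 <= x j 0,
               forall i j, (i, j) \in U2 -> y i 0 = x j 0 &
               forall i j, (i, j) \in U3 -> y i 0 >= x j 0]].

(* Layers are numbered 0, ..., n, so the arcs leaving layer i : 'I_n decide
   coordinate i.  Parallel arcs are allowed; acyclicity follows from
   [dd_arc_layer]. *)
Record decision_diagram (n : nat) := DecisionDiagram {
  dd_node : finType;
  dd_arc : finType;
  dd_layer : dd_node -> 'I_n.+1;
  dd_src : dd_arc -> dd_node;
  dd_tgt : dd_arc -> dd_node;
  dd_label : dd_arc -> bool;
  dd_root : dd_node;
  dd_term : dd_node;
  dd_layer_nonempty : forall i, exists v, dd_layer v = i;
  dd_first_layer : forall v, dd_layer v = ord0 <-> v = dd_root;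
  dd_last_layer : forall v, dd_layer v = ord_max <-> v = dd_term;
  dd_arc_layer : forall a,
    dd_layer (dd_tgt a) = (dd_layer (dd_src a)).+1 :> nat
}.

Fixpoint dd_path {n : nat} (D : decision_diagram n)
    (u : dd_node D) (s : seq (dd_arc D)) (v : dd_node D) : bool :=
  if s is a :: s' then (dd_src a == u) && dd_path (dd_tgt a) s' v else u == v.

(* On a root-terminal path this determines y, since such a path has exactly
   one arc leaving each layer i : 'I_n. *)
Definition dd_encodes {R : realType} {n : nat} (D : decision_diagram n)
    (s : seq (dd_arc D)) (y : 'cV[R]_n) : Prop :=
  forall (a : dd_arc D) (i : 'I_n), a \in s ->
    dd_layer (dd_src a) = i :> nat -> y i 0 = (dd_label a)%:R.

Definition dd_solutions {R : realType} {n : nat} (D : decision_diagram n) :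
    set 'cV[R]_n :=
  [set y : 'cV[R]_n | exists2 s : seq (dd_arc D),
     dd_path (dd_root D) s (dd_term D) & dd_encodes s y].

Definition dd_exact {R : realType} {n : nat}
    (D : decision_diagram n) (B : set 'cV[R]_n) : Prop :=
  dd_solutions D = B.

Definition dd_relaxed {R : realType} {n : nat}
    (D : decision_diagram n) (B : set 'cV[R]_n) : Prop :=
  B `<=` dd_solutions D.

Definition dd_incidence {R : realType} {n : nat} (D : decision_diagram n) :
    'M[R]_(#|dd_node D|, #|dd_arc D|) :=
  \matrix_(v, a)
    if dd_src (enum_val a) == enum_val v then -1
    else if dd_tgt (enum_val a) == enum_val v then 1 else 0.

Definition dd_supply {R : realType} {n : nat} (D : decision_diagram n) :
    'cV[R]_#|dd_node D| :=
  \col_v if enum_val v == dd_root D then -1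
         else if enum_val v == dd_term D then 1 else 0.

Definition dd_arcs1 {n : nat} (D : decision_diagram n) (i : 'I_n) :
    {set dd_arc D} :=
  [set a | ((dd_layer (dd_src a) : nat) == i) && dd_label a]%SET.

Definition network_flow {R : realType} {n : nat} (D : decision_diagram n) :
    set ('cV[R]_n * 'cV[R]_#|dd_arc D|) :=
  [set yz : 'cV[R]_n * 'cV[R]_#|dd_arc D| | [/\ forall a, 0 <= yz.2 a 0,
                dd_incidence D *m yz.2 = dd_supply D &
                forall i, yz.1 i 0 =
                  \sum_(a < #|dd_arc D| | enum_val a \in dd_arcs1 D i)
                    yz.2 a 0]].

Arguments network_flow {R n} D.

Definition proj_network_flow {R : realType} {n : nat}
    (D : decision_diagram n) : set 'cV[R]_n :=
  fst @` network_flow D.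

Definition model_feasible {R : realType} {m n J p k q : nat}
    (X : set 'cV[R]_m) (g : 'I_J -> 'cV[R]_n) (h : 'I_J -> R)
    (T : 'M[R]_(p, n)) (U1 U2 U3 : {set 'I_n * 'I_m})
    (J1 : 'I_k -> {set 'I_J}) (J2 : 'I_q -> {set 'I_J})
    (D Douter : {set 'I_J} -> decision_diagram n)
    (x : 'cV[R]_m) (y : 'cV[R]_n) (lambda : 'cV[R]_p) : Prop :=
  [/\ T^T *m lambda = y,
      forall i, proj_network_flow (D (J1 i)) y,
      forall i, proj_network_flow (Douter (J2 i)) y,
      recourse_relaxation g h y &
      [/\ selective U1 U2 U3 x y, X x & forall i, 0 <= lambda i 0]].

(* ereal_inf and ereal_sup follow the convention that the minimum over an
   empty set is +oo. *)
Definition model_value {R : realType} {m n p : nat}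
    (c : 'cV[R]_m) (d : 'cV[R]_p)
    (feasible : 'cV[R]_m -> 'cV[R]_n -> 'cV[R]_p -> Prop) : \bar R :=
  ereal_inf [set v | exists x y lambda,
    feasible x y lambda /\ v = (dot c x + dot d lambda)%:E].

Definition model_optimal {R : realType} {m n p : nat}
    (c : 'cV[R]_m) (d : 'cV[R]_p)
    (feasible : 'cV[R]_m -> 'cV[R]_n -> 'cV[R]_p -> Prop)
    (x : 'cV[R]_m) (y : 'cV[R]_n) (lambda : 'cV[R]_p) : Prop :=
  feasible x y lambda /\
  forall x' y' lambda', feasible x' y' lambda' ->
    dot c x + dot d lambda <= dot c x' + dot d lambda'.

Definition two_stage_value {R : realType} {m n : nat}
    (c : 'cV[R]_m) (X : set 'cV[R]_m) (Xi : set 'cV[R]_n)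
    (Y : set 'cV[R]_n) (S : 'cV[R]_m -> set 'cV[R]_n) : \bar R :=
  ereal_inf [set ereal_sup [set
    ereal_inf [set (dot c x + dot xi y)%:E | y in Y `&` S x]
    | xi in Xi] | x in X].

(* Main.v *)
Require Import Defs.
From HB Require Import structures.
From mathcomp Require Import all_boot all_order all_algebra.
From mathcomp Require Import all_classical all_reals all_analysis.
From mathcomp Require Import ring lra.

Set Implicit Arguments.
Unset Strict Implicit.
Unset Printing Implicit Defensive.

Import Order.TTheory GRing.Theory Num.Theory.
Import numFieldNormedType.Exports.

Local Open Scope classical_set_scope.
Local Open Scope ring_scope.

(** Fix a first-stage decision [x] and let [y_1, ..., y_N] be the points of
    the recourse set that are compatible with [x].  There are finitely many,
    because they are binary vectors.  The worst case of [x] is the supremum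
    over [xi] in the polytope of [min_i <xi, y_i>], and it is the value of the
    linear program that maximizes [t] subject to [T xi <= d] and
    [t <= <xi, y_i>] for all [i].  Linear programming duality yields
    multipliers [lambda >= 0] of the first constraints and [mu >= 0] of the
    others, with [sum_i mu_i = 1], [T^T lambda = sum_i mu_i y_i] and
    [<d, lambda>] at most the worst case ([scenario_duality]).

    So [lambda] together with the convex combination [y = sum_i mu_i y_i] is
    the natural candidate for the model, and its objective value is already
    small enough.  It is feasible since every constraint that the model puts
    on [y] is convex and holds at each [y_i].  For the diagrams the latter
    holds because each [y_i] satisfies any subfamily of the constraints, hence
    is the label vector of a root-terminal path, and the arcs of that path
    carry one unit of flow ([dd_solutions_proj_network_flow]).  Exact and
    relaxed diagrams alike have this path, since their solutions contain the
    set that they describe.  A decision without compatible recourse has worst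
    case [+oo], so the bound is immediate for it.

    Duality is derived from the homogeneous Farkas lemma for linear forms on
    an arbitrary module ([farkas]), applied after homogenization. *)

(** * Farkas' lemma and duality for finitely many recourse vectors *)

(** Induction on the number of forms, after D. Bartl.  If the form [f j]
    cannot simply be dropped, some [x0] satisfies the other inequalities and
    has [b x0 > 0], so that [f j x0 > 0].  Projecting along [x0] onto the
    kernel of [f j] turns the remaining forms into a family to which the
    induction hypothesis applies, and the sign conditions at [x0] make the
    resulting coefficient of [f j] nonnegative. *)
Lemma farkas (R : realFieldType) (V : lmodType R) (I : eqType) (r : seq I)
    (f : I -> V -> R) (b : V -> R) :
  uniq r -> (forall i, scalar (f i)) -> scalar b ->
  (forall x, (forall i, i \in r -> f i x <= 0) -> b x <= 0) ->
  exists2 w : I -> R, (forall i, 0 <= w i) &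
    forall x, b x = \sum_(i <- r) w i * f i x.
Proof.
move=> + + bL; elim: r f b bL => [|j r IHr] f b bL /=.
  move=> _ _ b_le0; exists (fun=> 0) => // x; rewrite big_nil.
  have {}b_le0 u : b u <= 0 by exact: b_le0.
  have b0 : b 0 = 0 by have := bL 1 0 0; rewrite scaler0 addr0; lra.
  have bN : b (- x) = - b x.
    by have := bL (-1) x 0; rewrite scaleN1r addr0 b0; lra.
  by have := b_le0 x; have := b_le0 (- x); rewrite bN; lra.
case/andP=> jr ur fL b_le0.
have [b_le0r|] := pselect (forall x, (forall i, i \in r -> f i x <= 0) -> b x <= 0).
  have [w w0 bE] := IHr f b bL ur fL b_le0r.
  exists (fun i => if i == j then 0 else w i) => [i|x]; first by case: ifP.
  rewrite big_cons eqxx mul0r add0r bE; apply: eq_big_seq => i ir.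
  by case: eqP jr => // <-; rewrite ir.
move/existsNP=> [x0 /not_implyP [fx0 /negP]]; rewrite -ltNge => bx0.
have c0 : 0 < f j x0.
  rewrite ltNge; apply/negP => fj; move: bx0; rewrite ltNge => /negP; apply.
  by apply: b_le0 => i; rewrite inE => /orP[/eqP->|/fx0].
(* [proj e] is [e] composed with the projection onto the kernel of [f j] along
   [x0], multiplied by [f j x0] to avoid a division. *)
pose proj (e : V -> R) x := f j x0 * e x - e x0 * f j x.
have projL e : scalar e -> scalar (proj e).
  by move=> eL a u v; rewrite /proj eL fL; ring.
have projE e : scalar e -> forall x, proj e x = e (f j x0 *: x - f j x *: x0).
  move=> eL x; have e0 : e 0 = 0 by have := eL 1 0 0; rewrite scaler0 addr0; lra.
  rewrite addrC -scaleNr eL -[f j x0 *: x]addr0 eL e0 /proj; ring.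
have [|i||w w0 bE] := IHr (fun i => proj (f i)) (proj b) _ ur.
- exact: projL.
- exact: projL.
- move=> x fx; rewrite projE //; apply: b_le0 => i.
  rewrite inE => /orP[/eqP->|/fx]; last by rewrite projE.
  by rewrite -projE // /proj; lra.
pose wj := (b x0 - \sum_(i <- r) w i * f i x0) / f j x0.
exists (fun i => if i == j then wj else w i) => [i|x].
  case: ifP => // _; apply: divr_ge0; last exact: ltW.
  rewrite subr_ge0; apply: le_trans (ltW bx0).
  rewrite big_seq; apply: sumr_le0 => l lr.
  by apply: mulr_ge0_le0 => //; apply: fx0.
rewrite big_cons eqxx.
have -> : \sum_(i <- r) (if i == j then wj else w i) * f i x =
    \sum_(i <- r) w i * f i x.
  by apply: eq_big_seq => i ir; case: eqP jr => // <-; rewrite ir.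
have sumE : \sum_(i <- r) w i * proj (f i) x =
    f j x0 * \sum_(i <- r) w i * f i x - (\sum_(i <- r) w i * f i x0) * f j x.
  rewrite mulr_sumr mulr_suml -sumrB; apply: eq_bigr => i _.
  by rewrite /proj; ring.
have := bE x; rewrite sumE /wj /proj => h.
have c_neq0 := lt0r_neq0 c0.
apply: (mulfI c_neq0); rewrite mulrDr mulrA mulrCA divff // mulr1.
by lra.
Qed.

Section Dot.
Variables (R : realType) (n : nat).
Implicit Types u v : 'cV[R]_n.

Lemma dotE u v : dot u v = \sum_i u i 0 * v i 0.
Proof. by rewrite /dot mxE; apply: eq_bigr => i _; rewrite mxE. Qed.

Lemma dotC u v : dot u v = dot v u.
Proof. by rewrite !dotE; apply: eq_bigr => i _; rewrite mulrC. Qed.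

Lemma dot_scalar u : scalar (dot u).
Proof. by move=> a v w; rewrite /dot mulmxDr -scalemxAr !mxE. Qed.

Lemma dot_sumr (I : finType) u (mu : I -> R) (y : I -> 'cV[R]_n) :
  dot u (\sum_i mu i *: y i) = \sum_i mu i * dot u (y i).
Proof.
rewrite /dot mulmx_sumr summxE.
by apply: eq_bigr => i _; rewrite -scalemxAr !mxE.
Qed.

End Dot.

(** Linear programming duality for the maximum of [t] subject to [T xi <= d]
    and [t <= <xi, y i>]: the second hypothesis says that [v] bounds this
    maximum.  Farkas' lemma applies to the homogenized system in
    [(xi, t, s)], and comparing coefficients of [xi], [t] and [s] gives the
    last three conclusions. *)
Lemma scenario_duality (R : realType) (p n : nat) (I : finType)
    (T : 'M[R]_(p, n)) (d : 'cV[R]_p) (y : I -> 'cV[R]_n) (v : R) :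
  polyhedron T d !=set0 ->
  (forall xi, polyhedron T d xi -> exists i, dot xi (y i) <= v) ->
  exists (lambda : 'cV[R]_p) (mu : I -> R),
    [/\ forall i, 0 <= lambda i 0, forall i, 0 <= mu i, \sum_i mu i = 1,
        T^T *m lambda = \sum_i mu i *: y i & dot d lambda <= v].
Proof.
move=> [xi0 Pxi0] yv.
pose V := ('cV[R]_n * R^o * R^o)%type.
pose F (a : 'I_p + I + 'I_1) (w : V) : R := match a with
  | inl (inl i) => (T *m w.1.1) i 0 - d i 0 * w.2
  | inl (inr i) => w.1.2 - dot (y i) w.1.1
  | inr _ => - w.2
  end.
(* Homogenized form of [t <= v]. *)
pose b (w : V) : R := w.1.2 - v * w.2.
have FL a : scalar (F a).
  move=> e [[u1 u2] u3] [[v1 v2] v3]; case: a => [[i|i]|i] /=.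
  - by rewrite mulmxDr -scalemxAr !mxE /GRing.scale /=; ring.
  - by rewrite dot_scalar /GRing.scale /=; ring.
  - by rewrite /GRing.scale /=; ring.
have bL : scalar b.
  by move=> e [[u1 u2] u3] [[v1 v2] v3]; rewrite /b /= /GRing.scale /=; ring.
have b_le0_pos w : 0 < w.2 -> (forall a, F a w <= 0) -> b w <= 0.
  case: w => [[xi t] s] /= s0 Fw.
  have [|i] := yv (s^-1 *: xi).
    move=> i; rewrite -scalemxAr mxE mulrC ler_pdivrMr //.
    by have := Fw (inl (inl i)); rewrite /= subr_le0.
  rewrite dotC -[s^-1 *: xi]addr0 dot_scalar.
  have -> : dot (y i) 0 = 0 by rewrite /dot mulmx0 mxE.
  rewrite addr0 mulrC ler_pdivrMr // /b /=.
  by have := Fw (inl (inr i)); rewrite /=; lra.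
have [||||w w0 bE] := @farkas R V _ (index_enum _) F b.
- exact: index_enum_uniq.
- exact: FL.
- exact: bL.
- move=> w Fw.
  (* When [s = 0], rescaling is impossible.  Adding a small multiple of the
     feasible point [w1], where [s = 1], reduces to [s > 0]; the multiple
     [b w / (1 - b w1)] is small enough to keep [b] positive if [b w] is. *)
  pose w1 : V := (xi0, - \sum_i `|dot (y i) xi0|, 1).
  have Fw1 a : F a w1 <= 0.
    case: a => [[i|i]|i] /=; last by rewrite lerN10.
      by rewrite mulr1 subr_le0.
    have : `|dot (y i) xi0| <= \sum_i `|dot (y i) xi0|.
      by rewrite (bigD1 i) //= lerDl sumr_ge0.
    by have := ler_norm (- dot (y i) xi0); rewrite normrN; lra.
  have bw1 : b w1 <= 0 by apply: b_le0_pos => //=.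
  rewrite leNgt; apply/negP => bw.
  have b1 : 0 < 1 - b w1 by lra.
  have e0 : 0 < b w / (1 - b w1) by apply: divr_gt0.
  have : b (b w / (1 - b w1) *: w1 + w) <= 0.
    apply: b_le0_pos => [|a].
      have := Fw (inr ord0) (mem_index_enum _).
      rewrite /= /GRing.scale /= mulr1 => ?; lra.
    rewrite FL; have := Fw a (mem_index_enum _).
    have := mulr_ge0_le0 (ltW e0) (Fw1 a); lra.
  rewrite bL; suff -> : b w / (1 - b w1) * b w1 + b w = b w / (1 - b w1).
    by rewrite leNgt e0.
  by field; apply: lt0r_neq0.
pose lambda : 'cV[R]_p := \col_i w (inl (inl i)).
have {}bE x : b x = \sum_i w (inl (inl i)) * F (inl (inl i)) x
    + \sum_i w (inl (inr i)) * F (inl (inr i)) x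
    + w (inr ord0) * F (inr ord0) x.
  by rewrite bE !big_sumType /= big_ord1.
exists lambda, (fun i => w (inl (inr i))); split.
- by move=> i; rewrite mxE.
- by [].
- have := bE (0, 1, 0); rewrite /b /= => h.
  rewrite big1 ?add0r in h; last by move=> i _; rewrite mulmx0 mxE; ring.
  rewrite mulr0 subr0 oppr0 mulr0 addr0 in h.
  rewrite h; apply: eq_bigr => i _.
  by rewrite /dot mulmx0 mxE; ring.
- apply/colP => j.
  have := bE (delta_mx j 0, 0, 0); rewrite /b /= => h.
  have h1 : (T^T *m lambda) j 0 = \sum_i w (inl (inl i)) *
      ((T *m (delta_mx j 0 : 'cV[R]_n)) i 0 - d i 0 * 0).
    rewrite mxE; apply: eq_bigr => i _; rewrite !mxE mulr0 subr0 mulrC.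
    congr (_ * _); rewrite (bigD1 j) //= big1 ?addr0 => [|l lj].
      by rewrite mxE !eqxx mulr1.
    by rewrite mxE (negPf lj) mulr0.
  have h2 : (\sum_i w (inl (inr i)) *: y i) j 0 = - \sum_i w (inl (inr i)) *
      (0 - dot (y i) (delta_mx j 0)).
    rewrite summxE -sumrN; apply: eq_bigr => i _; rewrite mxE.
    rewrite sub0r mulrN opprK; congr (_ * _).
    rewrite dotE (bigD1 j) //= big1 ?addr0 => [|l lj].
      by rewrite mxE !eqxx mulr1.
    by rewrite mxE (negPf lj) mulr0.
  rewrite h1 h2; lra.
- have := bE (0, 0, 1); rewrite /b /= => h.
  rewrite [X in _ + X + _]big1 in h; last first.
    by move=> i _; rewrite /dot mulmx0 mxE; ring.
  have h1 : dot d lambda = - \sum_i w (inl (inl i)) *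
      ((T *m (0 : 'cV[R]_n)) i 0 - d i 0 * 1).
    rewrite dotE -sumrN; apply: eq_bigr => i _; rewrite mulmx0 !mxE; ring.
  have := w0 (inr ord0); lra.
Qed.
(** * Root-terminal paths as unit flows *)

Lemma dd_arc_noloop (n : nat) (D : decision_diagram n) (a : dd_arc D) :
  dd_src a != dd_tgt a.
Proof.
apply/eqP => /(congr1 (fun v => (dd_layer v : nat))).
by rewrite dd_arc_layer => /n_Sn.
Qed.

Lemma dd_root_term (n : nat) (D : decision_diagram n) :
  (0 < n)%N -> dd_root D != dd_term D.
Proof.
move=> n0; apply/eqP => rt.
have := (dd_first_layer (dd_root D)).2 erefl.
rewrite rt ((dd_last_layer (dd_term D)).2 erefl) => /(congr1 val) /= nE.
by rewrite nE in n0.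
Qed.

Lemma sum_count (R : realType) (A : finType) (s : seq A) (F : A -> R) :
  \sum_a F a * (count_mem a s)%:R = \sum_(a <- s) F a.
Proof.
elim: s => [|a s IHs].
  by rewrite big_nil big1 // => a _; rewrite mulr0.
rewrite big_cons -IHs [in LHS](bigD1 a) //= [in RHS](bigD1 a) //= eqxx addrA.
congr (_ + _); first by rewrite natrD mulrDr mulr1.
by apply: eq_bigr => i /negPf; rewrite eq_sym => ->.
Qed.

Lemma sum_enum_val (R : realType) (A : finType) (F : A -> R) :
  \sum_(a < #|A|) F (enum_val a) = \sum_a F a.
Proof. by rewrite -(big_enum_val F). Qed.

(** The contributions of consecutive arcs telescope. *)
Lemma dd_path_net_flow (R : realType) (n : nat) (D : decision_diagram n)
    (u v w : dd_node D) (s : seq (dd_arc D)) : dd_path u s w ->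
  \sum_(a <- s) ((dd_tgt a == v)%:R - (dd_src a == v)%:R)
  = (w == v)%:R - (u == v)%:R :> R.
Proof.
elim: s u => [|a s IHs] u /=; first by move=> /eqP ->; rewrite big_nil subrr.
by case/andP => /eqP <- /IHs; rewrite big_cons => ->; ring.
Qed.

(** A path ending at the terminal has exactly one arc out of layer [i] when it
    starts at or before that layer, and none otherwise.  The indicator makes
    this provable by induction on the path. *)
Lemma dd_path_label_sum (R : realType) (n : nat) (D : decision_diagram n)
    (u : dd_node D) (s : seq (dd_arc D)) (y : 'cV[R]_n) (i : 'I_n) :
  dd_path u s (dd_term D) -> dd_encodes s y ->
  \sum_(a <- s) (a \in dd_arcs1 D i)%:R = (dd_layer u <= i)%:R * y i 0.
Proof.
elim: s u => [|a s IHs] u /=.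
  move=> /eqP -> _; rewrite big_nil ((dd_last_layer (dd_term D)).2 erefl) /=.
  by rewrite leqNgt ltn_ord mul0r.
case/andP => /eqP <- sp enc.
rewrite big_cons (IHs _ sp) => [|b j bs]; last by apply: enc; rewrite inE bs orbT.
rewrite dd_arc_layer !inE; case: ltngtP => //= [_|_|ai].
- by rewrite add0r.
- by rewrite !mul0r addr0.
- by rewrite mul0r addr0 mul1r (enc a i) ?inE ?eqxx.
Qed.

(** The flow on an arc is the number of times the path uses it. *)
Lemma dd_solutions_proj_network_flow (R : realType) (n : nat)
    (D : decision_diagram n) :
  (0 < n)%N -> @dd_solutions R n D `<=` proj_network_flow D.
Proof.
move=> n0 y [s sp enc].
exists (y, \col_a (count_mem (enum_val a) s)%:R) => //; split => /=.
- by move=> a; rewrite mxE.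
- apply/colP => v; rewrite !mxE.
  under eq_bigr do rewrite !mxE.
  rewrite (sum_enum_val (fun a => (if dd_src a == enum_val v then -1
     else if dd_tgt a == enum_val v then 1 else 0) * (count_mem a s)%:R : R)) sum_count.
  move: (enum_val v) => {}v.
  transitivity (\sum_(a <- s) ((dd_tgt a == v)%:R - (dd_src a == v)%:R) : R).
    (* The incidence entry tests the tail first, so it agrees with the
       difference of indicators only because tail and head differ. *)
    apply: eq_bigr => a _.
    have := dd_arc_noloop a; case: (dd_src a =P v) => [->|_] ne.
      by rewrite eq_sym (negPf ne) sub0r.
    by rewrite subr0; case: eqP.
  rewrite (dd_path_net_flow _ _ sp) ![_ == v]eq_sym.
  have := dd_root_term D n0; case: (v =P dd_root D) => [<-|_] ne.
    by rewrite (negPf ne) sub0r.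
  by rewrite subr0; case: eqP.
- move=> i.
  under eq_bigr do rewrite mxE.
  rewrite big_mkcond (sum_enum_val (fun a => if a \in dd_arcs1 D i
     then (count_mem a s)%:R else 0 : R)).
  transitivity (\sum_a (a \in dd_arcs1 D i)%:R * (count_mem a s)%:R : R).
    rewrite sum_count (dd_path_label_sum i sp enc).
    by rewrite ((dd_first_layer (dd_root D)).2 erefl) leq0n mul1r.
  by apply: eq_bigr => a _; case: ifP; rewrite ?mul1r ?mul0r.
Qed.

(** * Convexity of the constraints on the recourse vector *)

Section ConvexCombination.
Variables (R : realType) (n : nat) (I : finType) (mu : I -> R).
Hypotheses (mu_ge0 : forall i, 0 <= mu i) (mu_sum : \sum_i mu i = 1).

Lemma convex_comb_le (u v : I -> R) : (forall i, u i <= v i) ->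
  \sum_i mu i * u i <= \sum_i mu i * v i.
Proof. by move=> uv; apply: ler_sum => i _; apply: ler_wpM2l. Qed.

Lemma convex_comb_const (a : R) : \sum_i mu i * a = a.
Proof. by rewrite -mulr_suml mu_sum mul1r. Qed.

Lemma convex_comb_coord (y : I -> 'cV[R]_n) j :
  (\sum_i mu i *: y i) j 0 = \sum_i mu i * y i j 0.
Proof. by rewrite summxE; apply: eq_bigr => i _; rewrite mxE. Qed.

Lemma proj_network_flow_convex (D : decision_diagram n) (y : I -> 'cV[R]_n) :
  (forall i, proj_network_flow D (y i)) ->
  proj_network_flow D (\sum_i mu i *: y i).
Proof.
move=> yD.
have /choice[z zP] : forall i, exists z, network_flow D (y i, z).
  by move=> i; have [[y' z] yz /= <-] := yD i; exists z.
exists (\sum_i mu i *: y i, \sum_i mu i *: z i) => //; split => /=.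
- move=> a; rewrite summxE; apply: sumr_ge0 => i _.
  by rewrite mxE mulr_ge0 //; have [] := zP i.
- rewrite mulmx_sumr -[RHS]scale1r -mu_sum scaler_suml; apply: eq_bigr => i _.
  by have [_ <- _] := zP i; rewrite -scalemxAr.
- move=> j; rewrite convex_comb_coord.
  transitivity (\sum_i \sum_(a < #|dd_arc D| | enum_val a \in dd_arcs1 D j)
      mu i * z i a 0).
    by apply: eq_bigr => i _; have [_ _ ->] := zP i; rewrite mulr_sumr.
  rewrite exchange_big; apply: eq_bigr => a _.
  by rewrite summxE; apply: eq_bigr => i _; rewrite mxE.
Qed.

Lemma recourse_relaxation_convex J (g : 'I_J -> 'cV[R]_n) (h : 'I_J -> R)
    (y : I -> 'cV[R]_n) :
  (forall i, recourse_relaxation g h (y i)) ->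
  recourse_relaxation g h (\sum_i mu i *: y i).
Proof.
move=> yP; split => [j|j].
  rewrite convex_comb_coord; apply/andP; split.
    rewrite -[leLHS]convex_comb_const.
    by apply: convex_comb_le => i; have [/(_ j)/andP[]] := yP i.
  rewrite -[leRHS]convex_comb_const.
  by apply: convex_comb_le => i; have [/(_ j)/andP[]] := yP i.
rewrite dot_sumr -(convex_comb_const (h j)).
by apply: convex_comb_le => i; have [_] := yP i.
Qed.

Lemma selective_convex m (U1 U2 U3 : {set 'I_n * 'I_m}) (x : 'cV[R]_m)
    (y : I -> 'cV[R]_n) :
  (forall i, selective U1 U2 U3 x (y i)) ->
  selective U1 U2 U3 x (\sum_i mu i *: y i).
Proof.
move=> yP; split => i j ij; rewrite convex_comb_coord -(convex_comb_const (x j 0)).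
- by apply: convex_comb_le => l; have [/(_ i j ij)] := yP l.
- by apply: eq_bigr => l _; have [_ /(_ i j ij) -> _] := yP l.
- by apply: convex_comb_le => l; have [_ _ /(_ i j ij)] := yP l.
Qed.

End ConvexCombination.

(** * The worst case of a first-stage decision *)

Lemma recourse_set_relaxation (R : realType) (n J : nat)
    (g : 'I_J -> 'cV[R]_n) (h : 'I_J -> R) :
  recourse_set g h `<=` recourse_relaxation g h.
Proof.
move=> y [y01 yg]; split=> // i.
by case: (y01 i) => ->; rewrite lexx ler01.
Qed.

Lemma recourse_set_constraint_set (R : realType) (n J : nat)
    (g : 'I_J -> 'cV[R]_n) (h : 'I_J -> R) (S : {set 'I_J}) :
  recourse_set g h `<=` constraint_set g h S.
Proof. by move=> y [y01 yg]; split. Qed.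

Lemma binary_family (R : realType) (n : nat) (B : set 'cV[R]_n) :
  B `<=` [set y | binary y] ->
  exists (I : finType) (y : I -> 'cV[R]_n),
    (forall i, B (y i)) /\ forall z, B z -> exists i, y i = z.
Proof.
move=> B01.
pose vec (e : {ffun 'I_n -> bool}) : 'cV[R]_n := \col_i (e i)%:R.
exists {e : {ffun 'I_n -> bool} | `[< B (vec e) >]}, (fun e => vec (val e)).
split => [[e eB]|z zB]; first exact/asboolP.
have ze : vec [ffun i => z i 0 == 1] = z.
  apply/colP => i; rewrite !mxE ffunE.
  by case: (B01 z zB i) => ->; rewrite ?eqxx // eq_sym oner_eq0.
have eB : `[< B (vec [ffun i => z i 0 == 1]) >] by apply/asboolP; rewrite ze.
by exists (exist (fun e => `[< B (vec e) >] : Prop) _ eB).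
Qed.

(** Finiteness makes the inner minimum attained, which is what turns a bound on
    the worst case into the hypothesis of [scenario_duality]. *)
Lemma inf_finite_attained (R : realType) (I : finType) (T : Type) (B : set T)
    (y : I -> T) (F : T -> R) :
  (forall z, B z -> exists i, y i = z) -> B !=set0 ->
  exists i, ((F (y i))%:E <= ereal_inf [set (F z)%:E | z in B])%E.
Proof.
move=> By [z0 /By [i0 _]].
have [i _ imin] := @arg_minP _ _ I i0 predT (fun i => F (y i)) isT.
exists i; apply: le_ereal_inf_tmp => _ [z /By [j <-] <-].
by rewrite lee_fin imin.
Qed.

Theorem proposition6 (R : realType) (m n J p k q : nat)
    (c : 'cV[R]_m) (X : set 'cV[R]_m)
    (g : 'I_J -> 'cV[R]_n) (h : 'I_J -> R)
    (T : 'M[R]_(p, n)) (d : 'cV[R]_p)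
    (U1 U2 U3 : {set 'I_n * 'I_m})
    (J1 : 'I_k -> {set 'I_J}) (J2 : 'I_q -> {set 'I_J})
    (D Douter : {set 'I_J} -> decision_diagram n)
    (m_gt0 : (0 < m)%N) (n_gt0 : (0 < n)%N)
    (X_binary : forall x, X x -> binary x)
    (Xi_nonempty : polyhedron T d !=set0)
    (Xi_bounded : bounded_set (polyhedron T d))
    (U12 : (U1 :&: U2)%SET = finset.set0) (U13 : (U1 :&: U3)%SET = finset.set0)
    (U23 : (U2 :&: U3)%SET = finset.set0)
    (D_exact : forall S : {set 'I_J}, dd_exact (D S) (constraint_set g h S))
    (Douter_relaxed : forall S : {set 'I_J},
      dd_relaxed (Douter S) (constraint_set g h S)) :
  let feasible := model_feasible X g h T U1 U2 U3 J1 J2 D Douter in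
  (forall x y lambda, model_optimal c d feasible x y lambda -> X x) /\
  (model_value c d feasible <=
   two_stage_value c X (polyhedron T d) (recourse_set g h)
     (selective U1 U2 U3))%E.
Proof.
move=> feasible; split => [x y lambda [[_ _ _ _ [_ ? _]] _] //|].
apply: le_ereal_inf_tmp => _ [x Xx <-].
set B := recourse_set g h `&` selective U1 U2 U3 x.
set w := ereal_sup _.
have w_ub xi : polyhedron T d xi ->
    (ereal_inf [set (dot c x + dot xi y)%:E | y in B] <= w)%E.
  by move=> Pxi; apply: ereal_sup_ubound; exists xi.
(* Without compatible recourse the inner minimum is [+oo] for every [xi], and
   nonemptiness of the polyhedron carries this to the worst case. *)
have [B0|/nonemptyPn B0] := pselect (B !=set0); last first.
  have [xi0 /w_ub] := Xi_nonempty.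
  by rewrite B0 image_set0 ereal_inf0 leye_eq => /eqP ->; rewrite leey.
have [|I [y [yB By]]] := @binary_family R n B; first by move=> y [[]].
have worst xi : polyhedron T d xi -> exists i, ((dot c x + dot xi (y i))%:E <= w)%E.
  move=> Pxi.
  have [i yi] := inf_finite_attained (fun z => dot c x + dot xi z) By B0.
  by exists i; apply: le_trans yi (w_ub _ Pxi).
case: w worst {w_ub} => [w| |] worst; last 2 first.
- by rewrite leey.
- by have [xi0 /worst[i]] := Xi_nonempty; rewrite leeNy_eq.
have [|lambda [mu [lambda0 mu0 mu1 Tlambda dlambda]]] :=
    @scenario_duality R p n I T d y (w - dot c x) Xi_nonempty.
  move=> xi /worst[i]; rewrite lee_fin => wi; exists i; lra.
have yNF (E : decision_diagram n) S : constraint_set g h S `<=` dd_solutions E ->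
    proj_network_flow E (\sum_i mu i *: y i).
  move=> SE; apply: proj_network_flow_convex => // i.
  apply: dd_solutions_proj_network_flow => //; apply: SE.
  by apply: recourse_set_constraint_set; have [] := yB i.
apply: (@le_trans _ _ (dot c x + dot d lambda)%:E); last first.
  by rewrite lee_fin; lra.
apply: ereal_inf_lbound; exists x, (\sum_i mu i *: y i), lambda; split=> //.
split=> //.
- by move=> i; apply: (yNF _ (J1 i)); rewrite (D_exact (J1 i)).
- by move=> i; apply: (yNF _ (J2 i)); exact: Douter_relaxed.
- apply: recourse_relaxation_convex => // i.
  by apply: recourse_set_relaxation; have [] := yB i.
- by split=> //; apply: selective_convex => // i; have [] := yB i.
Qed.
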